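(* Let $\mathbb{K}$ be a ring with unit, $V$ a right $\mathbb{K}$-module and $U\subset V$ a non-empty subset. (1) The groupoid $U_0$ is a group bundle $TU:=U_0=U\times V$ over the base $U$, with fiber the group $(V,+)$. (2) The groupoid $U_1$ is isomorphic to the pair groupoid $U\times U$ over $U$. (3) More generally, for every $t\in\mathbb{K}^\times$, the groupoid $U_t$ is isomorphic to the pair groupoid over $U$, via $$\Phi_t:U_t\to U\times U,\quad (x,v)\mapsto(y,x):=(x+vt,x).$$ The non-singular groupoid $(U^{\{1\}})^\times$ is, via the map $(x,v,t)\mapsto(x+vt,x,t)$, isomorphic to the direct product $U\times U\times\mathbb{K}^\times$ of the pair groupoid of $U$ with the trivial groupoid of $\mathbb{K}^\times$. (4) If $\mathbb{K}$ is a field, then $U^{\{1\}}$ is isomorphic to a disjoint union of groupoids $$TU\ \dot\cup\ [(U\times U)\times\mathbb{K}^\times].$$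
   Context: $\mathbb{K}$ is not assumed commutative. $U^{\{1\}}:=\{(x,v,t)\in V\times V\times\mathbb{K}\mid x\in U,\ x+vt\in U\}$ is the groupoid with object set $U\times\mathbb{K}$, source $\pi_0(x,v,t)=(x,t)$, target $\pi_1(x,v,t)=(x+vt,t)$, units $z(x,t)=(x,0,t)$, and composition $(x',v',t)\ast(x,v,t)=(x,v'+v,t)$ defined when $x'=x+vt$. For fixed $t\in\mathbb{K}$, $U_t=\{(x,v)\in V\times V\mid x\in U,\ x+vt\in U\}$ is the groupoid over $U$ obtained by restricting to the fiber over $t$ (source $x$, target $x+vt$, composition $(x',v')\ast(x,v)=(x,v'+v)$). $(U^{\{1\}})^\times=\{(x,v,t)\in U^{\{1\}}\mid t\in\mathbb{K}^\times\}$ with the induced structure, over $U\times\mathbb{K}^\times$. The pair groupoid of a set $A$ has objects $A$, morphisms $A\times A$, source $(x,y)\mapsto y$, target $(x,y)\mapsto x$, units $(x,x)$, composition $(x,y)\circ(y,z)=(x,z)$. The trivial groupoid of a set has only identity morphisms. A group bundle is a groupoid whose source and target maps coincide. *)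

(* Defs.v *)
From mathcomp Require Import all_boot all_algebra.
From mathcomp Require Import all_classical.

Set Implicit Arguments.
Unset Strict Implicit.
Unset Printing Implicit Defensive.

Import GRing.Theory.
Local Open Scope ring_scope.
Local Open Scope classical_set_scope.

(** * Groupoids *)

(* The composite [comp g f] is "g after f"; it takes a proof that [g] starts
   where [f] ends, so that it is defined exactly on composable pairs. *)
Record is_groupoid (obj mor : Type) (src tgt : mor -> obj) (unit : obj -> mor)
    (comp : forall g f : mor, src g = tgt f -> mor) : Prop := IsGroupoid {
  src_unit_ax : forall x, src (unit x) = x;
  tgt_unit_ax : forall x, tgt (unit x) = x;
  src_comp_ax : forall g f (e : src g = tgt f), src (comp g f e) = src f;
  tgt_comp_ax : forall g f (e : src g = tgt f), tgt (comp g f e) = tgt g;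
  comp_unitl_ax : forall x f (e : src (unit x) = tgt f), comp (unit x) f e = f;
  comp_unitr_ax : forall x f (e : src f = tgt (unit x)), comp f (unit x) e = f;
  compA_ax : forall h g f (ehg : src h = tgt g) (egf : src g = tgt f)
    (e1 : src (comp h g ehg) = tgt f) (e2 : src h = tgt (comp g f egf)),
    comp (comp h g ehg) f e1 = comp h (comp g f egf) e2;
  comp_inv_ax : forall f, exists g (e : src g = tgt f) (e' : src f = tgt g),
    comp g f e = unit (src f) /\ comp f g e' = unit (tgt f)
}.

Record groupoid := Groupoid {
  obj : Type;
  mor : Type;
  src : mor -> obj;
  tgt : mor -> obj;
  unit : obj -> mor;
  comp : forall g f : mor, src g = tgt f -> mor;
  groupoidP : is_groupoid unit comp
}.

Arguments src {g0} _ : rename.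
Arguments tgt {g0} _ : rename.
Arguments unit {g0} _ : rename.
Arguments comp {g0} g f _ : rename.

Record is_groupoid_iso (G H : groupoid) (phi0 : obj G -> obj H)
    (phi1 : mor G -> mor H) : Prop := IsGroupoidIso {
  iso_obj_bij : bijective phi0;
  iso_mor_bij : bijective phi1;
  iso_src : forall f, src (phi1 f) = phi0 (src f);
  iso_tgt : forall f, tgt (phi1 f) = phi0 (tgt f);
  iso_unit : forall x, phi1 (unit x) = unit (phi0 x);
  iso_comp : forall g f (e : src g = tgt f) (e' : src (phi1 g) = tgt (phi1 f)),
    phi1 (comp g f e) = comp (phi1 g) (phi1 f) e'
}.

Definition isomorphic (G H : groupoid) : Prop :=
  exists (phi0 : obj G -> obj H) (phi1 : mor G -> mor H),
    is_groupoid_iso phi0 phi1.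

Definition is_group_bundle (G : groupoid) : Prop :=
  forall f : mor G, src f = tgt f.

(* [p], restricted to the group of all morphisms from [x] to [x], is an
   isomorphism onto the additive group [A]. *)
Definition is_fiber_group_iso (G : groupoid) (A : zmodType) (x : obj G)
    (p : mor G -> A) : Prop :=
  set_bij [set f : mor G | src f = x /\ tgt f = x] [set: A] p /\
  forall g f (e : src g = tgt f), src f = x -> tgt f = x -> tgt g = x ->
    p (comp g f e) = p g + p f.

Section PairGroupoid.
Context (A : Type).

Lemma pair_groupoidP : @is_groupoid A (A * A) snd fst (fun x => (x, x))
  (fun g f _ => (g.1, f.2)).
Proof.
split=> //.
- by move=> x [y z] /= ->.
- by move=> x [y z] /= <-.
- by move=> [x y]; exists (y, x), erefl, erefl.
Qed.

Definition pair_groupoid : groupoid := Groupoid pair_groupoidP.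

Lemma trivial_groupoidP : @is_groupoid A A id id id (fun g f _ => f).
Proof. by split=> // f; exists f, erefl, erefl. Qed.

Definition trivial_groupoid : groupoid := Groupoid trivial_groupoidP.

End PairGroupoid.

Section ProdGroupoid.
Context (G H : groupoid).

Definition prod_src (f : mor G * mor H) := (src f.1, src f.2).
Definition prod_tgt (f : mor G * mor H) := (tgt f.1, tgt f.2).
Definition prod_unit (x : obj G * obj H) := (unit x.1, unit x.2).
Definition prod_comp g f (e : prod_src g = prod_tgt f) : mor G * mor H :=
  (comp g.1 f.1 (congr1 fst e), comp g.2 f.2 (congr1 snd e)).

Lemma prod_groupoidP : is_groupoid prod_unit prod_comp.
Proof.
have [a1 a2 a3 a4 a5 a6 a7 a8] := groupoidP G.
have [b1 b2 b3 b4 b5 b6 b7 b8] := groupoidP H.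
split.
- by move=> [x y]; rewrite /prod_src a1 b1.
- by move=> [x y]; rewrite /prod_tgt a2 b2.
- by move=> g f e; rewrite /prod_src a3 b3.
- by move=> g f e; rewrite /prod_tgt a4 b4.
- by move=> x [f f'] e; rewrite /prod_comp a5 b5.
- by move=> x [f f'] e; rewrite /prod_comp a6 b6.
- by move=> *; congr pair; [exact: a7|exact: b7].
- move=> [f f']; have [g [e [e' [h h']]]] := a8 f.
  have [k [u [u' [w w']]]] := b8 f'.
  exists (g, k), (congr2 pair e u), (congr2 pair e' u').
  rewrite /prod_comp /prod_unit /= -h -h' -w -w'.
  by split; congr pair; congr comp; exact: Prop_irrelevance.
Qed.

Definition prod_groupoid : groupoid := Groupoid prod_groupoidP.

End ProdGroupoid.

Section SumGroupoid.
Context (G H : groupoid).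

Definition sum_src (f : mor G + mor H) : obj G + obj H :=
  match f with inl f => inl (src f) | inr f => inr (src f) end.
Definition sum_tgt (f : mor G + mor H) : obj G + obj H :=
  match f with inl f => inl (tgt f) | inr f => inr (tgt f) end.
Definition sum_unit (x : obj G + obj H) : mor G + mor H :=
  match x with inl x => inl (unit x) | inr x => inr (unit x) end.

Lemma inl_neq_inr (A B : Type) (a : A) (b : B) : inl a <> inr b.
Proof. by []. Qed.

Lemma inr_neq_inl (A B : Type) (a : A) (b : B) : inr b <> inl a.
Proof. by []. Qed.

Definition sum_comp (g f : mor G + mor H) :
    sum_src g = sum_tgt f -> mor G + mor H :=
  match g, f with
  | inl g, inl f => fun e => inl (comp g f (inl_inj e))
  | inr g, inr f => fun e => inr (comp g f (inr_inj e))
  | inl _, inr _ => fun e => False_rect _ (inl_neq_inr e)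
  | inr _, inl _ => fun e => False_rect _ (inr_neq_inl e)
  end.

Lemma sum_groupoidP : is_groupoid sum_unit sum_comp.
Proof.
have [a1 a2 a3 a4 a5 a6 a7 a8] := groupoidP G.
have [b1 b2 b3 b4 b5 b6 b7 b8] := groupoidP H.
split.
- by move=> [x|x] /=; rewrite ?a1 ?b1.
- by move=> [x|x] /=; rewrite ?a2 ?b2.
- by move=> [g|g] [f|f] e //=; rewrite ?a3 ?b3.
- by move=> [g|g] [f|f] e //=; rewrite ?a4 ?b4.
- by move=> [x|x] [f|f] e //=; rewrite ?a5 ?b5.
- by move=> [x|x] [f|f] e //=; rewrite ?a6 ?b6.
- move=> [h|h] [g|g] [f|f] // e1 e2 e3 e4 //=; congr (_ _).
  + exact: a7.
  + exact: b7.
- move=> [f|f].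
  + have [g [e [e' [h h']]]] := a8 f.
    exists (inl g), (congr1 inl e), (congr1 inl e') => /=; rewrite -h -h'.
    by split; congr (inl (comp _ _ _)); exact: Prop_irrelevance.
  + have [g [e [e' [h h']]]] := b8 f.
    exists (inr g), (congr1 inr e), (congr1 inr e') => /=; rewrite -h -h'.
    by split; congr (inr (comp _ _ _)); exact: Prop_irrelevance.
Qed.

Definition sum_groupoid : groupoid := Groupoid sum_groupoidP.

End SumGroupoid.

(** * The groupoids of a subset of a right module *)

(* The element of the subtype [A] given by [x] and a proof of [A x]. *)
Definition insubset (T : Type) (A : set T) (x : T) (Ax : A x) : A :=
  SigSub (mem_set Ax).

(* Neither commutativity nor [1 != 0] is assumed of [K], hence no structure
   with a decidable unit predicate can be used. *)
Definition ring_units (K : pzRingType) : set K :=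
  [set t | exists s, s * t = 1 /\ t * s = 1].

(* A field need not be commutative here, just as [K] itself need not be; a
   commutative field is a special case. *)
Definition ring_is_field (K : pzRingType) : Prop :=
  (1 : K) <> 0 /\ forall t : K, t <> 0 -> ring_units t.

(* A right [K]-module is a left module over the converse ring [K^c]. *)
Definition rscale (K : pzRingType) (V : lmodType K^c) (v : V) (t : K) : V :=
  (t : K^c) *: v.

Lemma rscaleDl (K : pzRingType) (V : lmodType K^c) (v w : V) (t : K) :
  rscale (v + w) t = rscale v t + rscale w t.
Proof. exact: scalerDr. Qed.

Lemma rscale_comp (K : pzRingType) (V : lmodType K^c) (x v w : V) (t : K) :
  x + rscale (w + v) t = x + rscale v t + rscale w t.
Proof. by rewrite rscaleDl addrA addrAC. Qed.

Lemma rscale_inv (K : pzRingType) (V : lmodType K^c) (x v : V) (t : K) :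
  x + rscale v t + rscale (- v) t = x.
Proof. by rewrite -rscale_comp addNr /rscale scaler0 addr0. Qed.

Lemma rscale_unit (K : pzRingType) (V : lmodType K^c) (x : V) (t : K) :
  x + rscale 0 t = x.
Proof. by rewrite /rscale scaler0 addr0. Qed.

Section FiberGroupoid.
Context (K : pzRingType) (V : lmodType K^c) (U : set V) (t : K).

Definition fiber_set : set (V * V) :=
  [set p | U p.1 /\ U (p.1 + rscale p.2 t)].

Definition fiber_src (f : fiber_set) : U := insubset (set_valP f).1.
Definition fiber_tgt (f : fiber_set) : U := insubset (set_valP f).2.

Lemma fiber_unit_subproof (x : U) : fiber_set (val x, 0).
Proof. by split=> /=; rewrite ?rscale_unit; exact: set_valP. Qed.

Definition fiber_unit (x : U) : fiber_set := insubset (fiber_unit_subproof x).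

Lemma fiber_comp_subproof (g f : fiber_set) : fiber_src g = fiber_tgt f ->
  fiber_set ((val f).1, (val g).2 + (val f).2).
Proof.
move=> /(congr1 val)/= e; split=> /=; first exact: (set_valP f).1.
by rewrite rscale_comp -e; exact: (set_valP g).2.
Qed.

Definition fiber_comp (g f : fiber_set) (e : fiber_src g = fiber_tgt f) :
  fiber_set := insubset (fiber_comp_subproof e).

Lemma fiber_groupoidP : is_groupoid fiber_unit fiber_comp.
Proof.
split.
- by move=> x; apply: val_inj.
- by move=> x; apply: val_inj; rewrite /= rscale_unit.
- by move=> g f e; apply: val_inj.
- move=> g f e; apply: val_inj; rewrite /= rscale_comp.
  by move/(congr1 val): e => /= <-.
- by move=> x f e; apply: val_inj; rewrite /= add0r; case: (val f).
- move=> x f e; apply: val_inj; rewrite /= addr0.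
  by move/(congr1 val): e; rewrite /= rscale_unit => <-; case: (val f).
- by move=> h g f *; apply: val_inj; rewrite /= addrA.
- move=> f; have [Ux Uy] := set_valP f.
  have Fg : fiber_set ((val f).1 + rscale (val f).2 t, - (val f).2).
    by split=> //=; rewrite rscale_inv.
  have e : fiber_src (insubset Fg) = fiber_tgt f by apply: val_inj.
  have e' : fiber_src f = fiber_tgt (insubset Fg).
    by apply: val_inj; rewrite /= rscale_inv.
  exists (insubset Fg), e, e'.
  by split; apply: val_inj; rewrite /= ?addNr ?addrN.
Qed.

Definition fiber_groupoid : groupoid := Groupoid fiber_groupoidP.

Definition Phi (f : fiber_set) : U * U := (fiber_tgt f, fiber_src f).

End FiberGroupoid.

Definition tangent_groupoid (K : pzRingType) (V : lmodType K^c) (U : set V) :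
  groupoid := fiber_groupoid U (0 : K).

Section FirstGroupoid.
Context (K : pzRingType) (V : lmodType K^c) (U : set V).

Definition first_set : set (V * V * K) :=
  [set p | U p.1.1 /\ U (p.1.1 + rscale p.1.2 p.2)].

Definition first_src (f : first_set) : U * K :=
  (insubset (set_valP f).1, (val f).2).
Definition first_tgt (f : first_set) : U * K :=
  (insubset (set_valP f).2, (val f).2).

Lemma first_unit_subproof (x : U * K) : first_set (val x.1, 0, x.2).
Proof. by split=> /=; rewrite ?rscale_unit; exact: set_valP. Qed.

Definition first_unit (x : U * K) : first_set :=
  insubset (first_unit_subproof x).

Lemma first_comp_subproof (g f : first_set) : first_src g = first_tgt f ->
  first_set ((val f).1.1, (val g).1.2 + (val f).1.2, (val f).2).
Proof.
move=> e; have /= e1 := congr1 (val \o fst) e; have /= e2 := congr1 snd e.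
split=> /=; first exact: (set_valP f).1.
by rewrite rscale_comp -e1 -e2; exact: (set_valP g).2.
Qed.

Definition first_comp (g f : first_set) (e : first_src g = first_tgt f) :
  first_set := insubset (first_comp_subproof e).

Lemma first_groupoidP : is_groupoid first_unit first_comp.
Proof.
split.
- by move=> [x t]; congr pair; apply: val_inj.
- by move=> [x t]; congr pair; apply: val_inj; rewrite /= rscale_unit.
- by move=> g f e; congr pair; apply: val_inj.
- move=> g f e; have /= e1 := congr1 (val \o fst) e.
  have /= e2 := congr1 snd e.
  by congr pair; first apply: val_inj; rewrite /= ?rscale_comp ?e2 ?e1.
- by move=> x f e; apply: val_inj; rewrite /= add0r; case: (val f) => -[].
- move=> x f e; have /= e1 := congr1 (val \o fst) e.
  have /= e2 := congr1 snd e; apply: val_inj; rewrite /= addr0 -e2.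
  by rewrite rscale_unit in e1; rewrite -e1; case: (val f) => -[].
- by move=> h g f *; apply: val_inj; rewrite /= addrA.
- move=> f; have [Ux Uy] := set_valP f.
  have Fg : first_set
      ((val f).1.1 + rscale (val f).1.2 (val f).2, - (val f).1.2, (val f).2).
    by split=> //=; rewrite rscale_inv.
  have e : first_src (insubset Fg) = first_tgt f.
    by congr pair; apply: val_inj.
  have e' : first_src f = first_tgt (insubset Fg).
    by congr pair; apply: val_inj; rewrite /= rscale_inv.
  exists (insubset Fg), e, e'.
  by split; apply: val_inj; rewrite /= ?addNr ?addrN.
Qed.

Definition first_groupoid : groupoid := Groupoid first_groupoidP.

End FirstGroupoid.

Section NonsingularGroupoid.
Context (K : pzRingType) (V : lmodType K^c) (U : set V).

Definition nonsing_set : set (V * V * K) :=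
  [set p | first_set U p /\ ring_units p.2].

Definition nonsing_scalar (f : nonsing_set) : ring_units (K := K) :=
  insubset (set_valP f).2.
Definition nonsing_src (f : nonsing_set) : U * ring_units (K := K) :=
  (insubset (set_valP f).1.1, nonsing_scalar f).
Definition nonsing_tgt (f : nonsing_set) : U * ring_units (K := K) :=
  (insubset (set_valP f).1.2, nonsing_scalar f).

Lemma nonsing_unit_subproof (x : U * ring_units (K := K)) :
  nonsing_set (val x.1, 0, val x.2).
Proof.
by split; [split=> /=; rewrite ?rscale_unit|]; exact: set_valP.
Qed.

Definition nonsing_unit (x : U * ring_units (K := K)) : nonsing_set :=
  insubset (nonsing_unit_subproof x).

Lemma nonsing_comp_subproof (g f : nonsing_set) :
  nonsing_src g = nonsing_tgt f ->
  nonsing_set ((val f).1.1, (val g).1.2 + (val f).1.2, (val f).2).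
Proof.
move=> e; have /= e1 := congr1 (val \o fst) e.
have /= e2 := congr1 (val \o snd) e.
split; last exact: (set_valP f).2.
split=> /=; first exact: (set_valP f).1.1.
by rewrite rscale_comp -e1 -e2; exact: (set_valP g).1.2.
Qed.

Definition nonsing_comp (g f : nonsing_set)
    (e : nonsing_src g = nonsing_tgt f) : nonsing_set :=
  insubset (nonsing_comp_subproof e).

Lemma nonsing_groupoidP : is_groupoid nonsing_unit nonsing_comp.
Proof.
split.
- by move=> [x t]; congr pair; apply: val_inj.
- by move=> [x t]; congr pair; apply: val_inj; rewrite /= ?rscale_unit.
- by move=> g f e; congr pair; apply: val_inj.
- move=> g f e; have /= e1 := congr1 (val \o fst) e.
  have /= e2 := congr1 (val \o snd) e.
  by congr pair; apply: val_inj; rewrite /= ?rscale_comp ?e2 ?e1.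
- by move=> x f e; apply: val_inj; rewrite /= add0r; case: (val f) => -[].
- move=> x f e; have /= e1 := congr1 (val \o fst) e.
  have /= e2 := congr1 (val \o snd) e; apply: val_inj; rewrite /= addr0 -e2.
  by rewrite rscale_unit in e1; rewrite -e1; case: (val f) => -[].
- by move=> h g f *; apply: val_inj; rewrite /= addrA.
- move=> f; have [[Ux Uy] tu] := set_valP f.
  have Fg : nonsing_set
      ((val f).1.1 + rscale (val f).1.2 (val f).2, - (val f).1.2, (val f).2).
    by split=> //; split=> //=; rewrite rscale_inv.
  have e : nonsing_src (insubset Fg) = nonsing_tgt f.
    by congr pair; apply: val_inj.
  have e' : nonsing_src f = nonsing_tgt (insubset Fg).
    by congr pair; apply: val_inj; rewrite /= ?rscale_inv.
  exists (insubset Fg), e, e'.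
  by split; apply: val_inj; rewrite /= ?addNr ?addrN.
Qed.

Definition nonsing_groupoid : groupoid := Groupoid nonsing_groupoidP.

Definition nonsing_Phi (f : nonsing_set) : (U * U) * ring_units (K := K) :=
  ((insubset (set_valP f).1.2, insubset (set_valP f).1.1), nonsing_scalar f).

End NonsingularGroupoid.

(* Main.v *)
(** The map [Phi_t] always preserves the groupoid structure; when [t] is a unit,
    [v] is recovered from [(y, x)] as [(y - x) t^-1], so [Phi_t] is bijective.
    Over a field every scalar is either zero or a unit, which splits [U^{1}]
    into its fiber over [0] and its non-singular part. *)

Require Import Defs.
From mathcomp Require Import all_boot all_algebra.
From mathcomp Require Import all_classical.

Set Implicit Arguments.
Unset Strict Implicit.
Unset Printing Implicit Defensive.

Import GRing.Theory.
Local Open Scope ring_scope.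
Local Open Scope classical_set_scope.

(** The inverse function is chosen classically, so later bijectivity proofs need no formula for it,
    although a unit is only known to have some inverse. *)
Lemma inj_surj_bijective (A B : Type) (f : A -> B) :
  injective f -> (forall y, exists x, f x = y) -> bijective f.
Proof.
move=> fI fS; rewrite -setTT_bijective.
split=> //; first by move=> ? ? _ _; exact: fI.
by move=> y _; have [x <-] := fS y; exists x.
Qed.

(** Composites carry a proof of composability, which blocks plain rewriting of their factors; proof
    irrelevance removes the obstacle. *)
Lemma eq_comp (G : groupoid) (g g' f f' : mor G) (e : src g = tgt f)
    (e' : src g' = tgt f') :
  g = g' -> f = f' -> Defs.comp g f e = Defs.comp g' f' e'.
Proof.
move=> gg' ff'; move: e e'; rewrite gg' ff' => e e'.
by congr Defs.comp; exact: Prop_irrelevance.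
Qed.

(** * Isomorphism of groupoids as an equivalence relation *)

Lemma isomorphic_refl (G : groupoid) : isomorphic G G.
Proof.
exists id, id; split=> //; try by exists id.
by move=> g f e e'; exact: eq_comp.
Qed.

Lemma isomorphic_sym (G H : groupoid) : isomorphic G H -> isomorphic H G.
Proof.
case=> phi0 [phi1 [[psi0 phi0K psi0K] [psi1 phi1K psi1K] sP tP uP cP]].
exists psi0, psi1; split.
- by exists phi0.
- by exists phi1.
- by move=> f; rewrite -{2}[f]psi1K sP phi0K.
- by move=> f; rewrite -{2}[f]psi1K tP phi0K.
- by move=> x; rewrite -{1}[x]psi0K -uP phi1K.
(* Both sides are compared after applying [phi1], where its own compatibility with composition is
   available. *)
- move=> g f e e'; apply: (can_inj phi1K); rewrite psi1K.
  have e2 : src (phi1 (psi1 g)) = tgt (phi1 (psi1 f)) by rewrite !psi1K.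
  by rewrite (cP _ _ e' e2); apply: eq_comp; rewrite psi1K.
Qed.

Lemma isomorphic_trans (G H L : groupoid) :
  isomorphic G H -> isomorphic H L -> isomorphic G L.
Proof.
case=> phi0 [phi1 [b0 b1 sP tP uP cP]] [psi0 [psi1 [b0' b1' sP' tP' uP' cP']]].
exists (psi0 \o phi0), (psi1 \o phi1); split.
- exact: bij_comp.
- exact: bij_comp.
- by move=> f /=; rewrite sP' sP.
- by move=> f /=; rewrite tP' tP.
- by move=> x /=; rewrite uP uP'.
- move=> g f e e' /=.
  have e1 : src (phi1 g) = tgt (phi1 f) by rewrite sP tP e.
  by rewrite (cP _ _ e e1) (cP' _ _ e1 e').
Qed.

(** * Isomorphisms between disjoint unions *)

Definition sum_map (A A' B B' : Type) (f : A -> A') (g : B -> B')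
    (x : A + B) : A' + B' :=
  match x with inl a => inl (f a) | inr b => inr (g b) end.

Lemma sum_map_bij (A A' B B' : Type) (f : A -> A') (g : B -> B') :
  bijective f -> bijective g -> bijective (sum_map f g).
Proof.
case=> f' fK f'K [g' gK g'K]; exists (sum_map f' g').
- by case=> [a|b] /=; rewrite ?fK ?gK.
- by case=> [a|b] /=; rewrite ?f'K ?g'K.
Qed.

Lemma sum_groupoid_isomorphic (G G' H H' : groupoid) :
  isomorphic G G' -> isomorphic H H' ->
  isomorphic (sum_groupoid G H) (sum_groupoid G' H').
Proof.
case=> phi0 [phi1 [b0 b1 sP tP uP cP]] [psi0 [psi1 [b0' b1' sP' tP' uP' cP']]].
exists (sum_map phi0 psi0), (sum_map phi1 psi1); split.
- exact: sum_map_bij.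
- exact: sum_map_bij.
- by case=> f /=; rewrite ?sP ?sP'.
- by case=> f /=; rewrite ?tP ?tP'.
- by case=> x /=; rewrite ?uP ?uP'.
- by move=> [g|g] [f|f] e e' //=; congr (_ _); [exact: cP|exact: cP'].
Qed.

(** * Right scalar multiplication by units *)

Section RightModule.
Context (K : pzRingType) (V : lmodType K^c).
Implicit Types (v : V) (s t : K).

Lemma rscale0 v : rscale v (0 : K) = 0.
Proof. exact: scale0r. Qed.

(** The product of [K^c] is reversed, which puts [s] before [t] here. *)
Lemma rscaleA v s t : rscale (rscale v s) t = rscale v (s * t).
Proof. exact: scalerA. Qed.

Lemma rscale1 v : rscale v (1 : K) = v.
Proof. exact: scale1r. Qed.

(** Scaling by [s] undoes scaling by [t] because [t * s = 1]; the next lemma relies on [s * t = 1]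
    instead. *)
Lemma rscale_unit_inj t : ring_units t -> injective (fun v => rscale v t).
Proof.
case=> s [_ ts] v w /(congr1 (fun z => rscale z s)).
by rewrite /= !rscaleA ts !rscale1.
Qed.

Lemma rscale_transitive t (x y : V) :
  ring_units t -> exists v, x + rscale v t = y.
Proof.
case=> s [st _]; exists (rscale (y - x) s).
by rewrite rscaleA st rscale1 addrC subrK.
Qed.

End RightModule.

(** * The fibers over zero and over units *)

Section SubsetGroupoids.
Context (K : pzRingType) (V : lmodType K^c) (U : set V).

Lemma tangent_group_bundle : is_group_bundle (tangent_groupoid U).
Proof. by move=> f; apply: val_inj; rewrite /= rscale0 addr0. Qed.

Lemma fiber_set0 : fiber_set U (0 : K) = U `*` [set: V].
Proof.
apply/seteqP; split=> -[x v] /= [Ux _] //.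
by split=> //=; rewrite rscale0 addr0.
Qed.

Lemma tangent_fiber_iso (x : U) :
  is_fiber_group_iso (G := tangent_groupoid U) (A := V) x
    (fun f : fiber_set U (0 : K) => (val f).2).
Proof.
split=> //; split=> //.
- move=> [[y v] Fy] [[z w] Fz]; rewrite !inE.
  move=> [/(congr1 val)/= yx _] [/(congr1 val)/= zx _] /= vw.
  by apply: val_inj; rewrite /= yx zx vw.
- move=> v _.
  (* Over the scalar 0 the target is the source, so every [v] is allowed at [x]. *)
  have Fv : fiber_set U (0 : K) (val x, v).
    by rewrite fiber_set0; split=> //=; exact: set_valP.
  exists (insubset Fv) => //.
  by split; apply: val_inj; rewrite /= ?rscale0 ?addr0.
Qed.

Lemma Phi_iso (t : K) : ring_units t ->
  is_groupoid_iso (G := fiber_groupoid U t) (H := pair_groupoid U)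
    (fun x : U => x) (Phi (U := U) (t := t)).
Proof.
move=> tu; split=> //.
- by exists id.
- apply: inj_surj_bijective.
  + move=> [[x v] Fx] [[y w] Fy] [] /= xvyw xy.
    apply: val_inj; rewrite /= xy; congr pair.
    (* With equal sources, cancelling the base point and then the unit [t] identifies [v] and
       [w]. *)
    by apply: (rscale_unit_inj tu); apply: (addrI y); rewrite -xvyw xy.
  + move=> [y x]; have [v xv] := rscale_transitive (val x) (val y) tu.
    have Fv : fiber_set U t (val x, v).
      by split=> /=; rewrite ?xv; exact: set_valP.
    by exists (insubset Fv); congr pair; apply: val_inj.
- by move=> x; congr pair; apply: val_inj; rewrite /= ?rscale_unit.
(* A pair composite keeps the target of [g] and the source of [f]; the first component is thus the
   target law of the fiber groupoid. *)
- move=> g f e e'; congr pair; last by apply: val_inj.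
  exact: (tgt_comp_ax (fiber_groupoidP U t)).
Qed.

Lemma nonsing_Phi_iso :
  is_groupoid_iso (G := nonsing_groupoid U)
    (H := prod_groupoid (pair_groupoid U)
            (trivial_groupoid (ring_units (K := K))))
    (fun x : U * ring_units (K := K) => x) (nonsing_Phi (U := U)).
Proof.
split=> //.
- by exists id.
- apply: inj_surj_bijective.
  + move=> [[[x v] s] Fx] [[[y w] t] Fy] [] /= xvyw xy st.
    apply: val_inj; rewrite /= xy st; congr (_, _, _).
    apply: (rscale_unit_inj (set_mem Fy).2); apply: (addrI y).
    by rewrite -xvyw xy st.
  + move=> [[y x] t]; have tu := set_valP t.
    have [v xv] := rscale_transitive (val x) (val y) tu.
    have Fv : nonsing_set U (val x, v, val t).
      by split=> //; split=> /=; rewrite ?xv; exact: set_valP.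
    by exists (insubset Fv); congr (_, _, _); apply: val_inj.
- by move=> [x t]; congr (_, _, _); apply: val_inj; rewrite /= ?rscale_unit.
- move=> g f e e'.
  have /= [tgtE _] := tgt_comp_ax (nonsing_groupoidP U) e.
  by congr (_, _, _); apply: val_inj.
Qed.

(** * Gluing the zero fiber and the non-singular part *)

Lemma fiber_first (t : K) (p : V * V) :
  fiber_set U t p -> first_set U (p.1, p.2, t).
Proof. by []. Qed.

Lemma nonsing_first (p : V * V * K) : nonsing_set U p -> first_set U p.
Proof. by case. Qed.

(** Mapping out of the disjoint union is a plain case analysis; the opposite direction would have to
    decide whether a scalar vanishes. *)
Definition glue_obj (x : U + U * ring_units (K := K)) : U * K :=
  match x with inl x => (x, 0) | inr x => (x.1, val x.2) end.

Definition glue (f : fiber_set U (0 : K) + nonsing_set U) : first_set U :=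
  match f with
  | inl f => insubset (fiber_first (set_valP f))
  | inr f => insubset (nonsing_first (set_valP f))
  end.

(** The first half makes the two glued pieces disjoint, the second makes them cover everything. *)
Lemma field_unitsP : ring_is_field K ->
  ~ ring_units (0 : K) /\ forall t : K, t = 0 \/ ring_units t.
Proof.
case=> K1 Ku; split; first by case=> s [+ _]; rewrite mulr0 => /esym.
by move=> t; have [->|/Ku] := pselect (t = 0); [left|right].
Qed.

Lemma glue_iso : ring_is_field K ->
  is_groupoid_iso (G := sum_groupoid (tangent_groupoid U) (nonsing_groupoid U))
    (H := first_groupoid U) glue_obj glue.
Proof.
move=> /field_unitsP [K0 Ku]; split.
- apply: inj_surj_bijective.
  + move=> [x|[x s]] [y|[y t]] //=.
    * by case=> ->.
    (* A coincidence between the two summands would make 0 a unit. *)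
    * by case=> _ t0; case: K0; rewrite t0; exact: set_valP.
    * by case=> _ s0; case: K0; rewrite -s0; exact: set_valP.
    * by case=> -> /val_inj ->.
  + move=> [x t]; have [->|tu] := Ku t; first by exists (inl x).
    by exists (inr (x, insubset tu)).
- apply: inj_surj_bijective.
  + move=> [[[x v] Fx]|f] [[[y w] Fy]|g] /(congr1 val) /=.
    * by case=> xy vw; congr inl; apply: val_inj; rewrite /= xy vw.
    * by move=> /(congr1 snd)/= t0; case: K0;
      rewrite t0; exact: (set_valP g).2.
    * by move=> /(congr1 snd)/= t0; case: K0;
      rewrite -t0; exact: (set_valP f).2.
    * by move=> /val_inj ->.
  + move=> [[[x v] t] Ft]; have Fxvt := set_mem Ft; have [t0|tu] := Ku t.
    * have Fv : fiber_set U (0 : K) (x, v) by rewrite -t0.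
      by exists (inl (insubset Fv)); apply: val_inj; rewrite /= t0.
    * have Fn : nonsing_set U (x, v, t) by [].
      by exists (inr (insubset Fn)); apply: val_inj.
- by case=> f; congr pair; apply: val_inj.
- by case=> f; congr pair; apply: val_inj.
- by case=> x; apply: val_inj.
(* Morphisms from different summands are never composable, so only the two unmixed cases remain. *)
- by move=> [g|g] [f|f] // e e'; apply: val_inj.
Qed.

End SubsetGroupoids.

Theorem theorem2p7 (K : pzRingType) (V : lmodType K^c) (U : set V)
    (U_nonempty : U !=set0) :
  (* (1) *)
  (is_group_bundle (tangent_groupoid U) /\
   fiber_set U (0 : K) = U `*` [set: V] /\
   forall x : U,
     is_fiber_group_iso (G := tangent_groupoid U) (A := V) x
       (fun f : fiber_set U (0 : K) => (val f).2)) /\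
  (* (2) *)
  (exists Psi : fiber_set U (1 : K) -> U * U,
     is_groupoid_iso (G := fiber_groupoid U (1 : K)) (H := pair_groupoid U)
       (fun x : U => x) Psi) /\
  (* (3) *)
  ((forall t : K, ring_units t ->
      is_groupoid_iso (G := fiber_groupoid U t) (H := pair_groupoid U)
        (fun x : U => x) (Phi (U := U) (t := t))) /\
   is_groupoid_iso (G := nonsing_groupoid U)
     (H := prod_groupoid (pair_groupoid U)
             (trivial_groupoid (ring_units (K := K))))
     (fun x : U * ring_units (K := K) => x) (nonsing_Phi (U := U))) /\
  (* (4) *)
  (ring_is_field K ->
   isomorphic (first_groupoid U)
     (sum_groupoid (tangent_groupoid U)
        (prod_groupoid (pair_groupoid U)
           (trivial_groupoid (ring_units (K := K)))))).
Proof.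
split; [|split; [|split]].
- split; first exact: tangent_group_bundle.
  by split; [exact: fiber_set0|exact: tangent_fiber_iso].
- have u1 : ring_units (1 : K) by exists 1; rewrite mulr1.
  by exists (Phi (U := U) (t := 1)); exact: Phi_iso.
- by split; [exact: Phi_iso|exact: nonsing_Phi_iso].
- move=> Kfield.
  have split0 : isomorphic
      (sum_groupoid (tangent_groupoid U) (nonsing_groupoid U))
      (first_groupoid U).
    by exists (@glue_obj K V U), (@glue K V U); exact: glue_iso.
  (* After splitting, the tangent summand stays fixed and [nonsing_Phi] turns the other into the
     product. *)
  apply: isomorphic_trans (isomorphic_sym split0) _.
  apply: sum_groupoid_isomorphic; first exact: isomorphic_refl.
  by exists id, (nonsing_Phi (U := U)); exact: nonsing_Phi_iso.
Qed.
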